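(* Let $N=\{1,\dots,n\}$ be a finite set of agents, let $S=[\underline{s},\overline{s}]\subset\mathbb{R}$ be the common signal space, and for each $i\in N$ let $v_i:S^n\to\mathbb{R}$ be such that, for every $s_{-i}$, the map $s_i\mapsto v_i(s_i,s_{-i})$ is convex, continuous and non-decreasing on $S$. A mechanism $(q,p)$ is ex-post incentive compatible if and only if $q$ is eventually monotone and, for all $i\in N$, $s_i\in S$ and $s_{-i}\in S^{n-1}$, $$p_i(s_i,s_{-i}) = p_i(\underline{s},s_{-i})-q_i(\underline{s},s_{-i})v_i(\underline{s},s_{-i})+ q_i(s_i,s_{-i})v_i(s_i,s_{-i})-\int^{s_i}_{\underline{s}}\frac{\partial v_i(x,s_{-i})}{\partial x}\, q_i(x,s_{-i}) \, dx .$$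
   Context: For a signal profile $s=(s_1,\dots,s_n)\in S^n$, $s_{-i}$ denotes the signals of the agents other than $i$, and $(s_i,s_{-i})=s$. A mechanism is a pair $(q,p)$ with allocation rules $q_i:S^n\to[0,1]$ and payment rules $p_i:S^n\to\mathbb{R}$, $i\in N$. The net payoff of agent $i$ is $u_i(s_i,s_{-i})=q_i(s_i,s_{-i})v_i(s_i,s_{-i})-p_i(s_i,s_{-i})$. Ex-post incentive compatible (EPIC): for all $i$, all $s_{-i}$ and all $s_i,s_i'\in S$, $$u_i(s_i,s_{-i})\ \ge\ u_i(s_i',s_{-i})+[v_i(s_i,s_{-i})-v_i(s_i',s_{-i})]\,q_i(s_i',s_{-i}).$$ For each $i$ and $s_{-i}$ let $\ell_{v_i}(s_{-i}):=\sup\{s_i\in S:\ v_i(s_i,s_{-i})=v_i(\underline{s},s_{-i})\}$. Eventually monotone: $q$ is eventually monotone if for all $i$, all $s_{-i}$, and all $s_i,s_i'\in S$ with $s_i>s_i'$ and $s_i>\ell_{v_i}(s_{-i})$, we have $q_i(s_i,s_{-i})\ge q_i(s_i',s_{-i})$. Derivative convention: $\frac{\partial v_i(x,s_{-i})}{\partial x}$ denotes the derivative of the convex function $v_i(\cdot,s_{-i})$ at $x$ wherever it exists (which is almost everywhere), and otherwise some selection from its subgradient at $x$. The integral is a Lebesgue integral, so values on a null set do not matter. *)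

(* Defs.v *)
From HB Require Import structures.
From mathcomp Require Import all_boot all_order all_algebra.
From mathcomp Require Import all_classical all_reals all_analysis.
Import Order.TTheory GRing.Theory Num.Theory.
Import numFieldNormedType.Exports.

Set Implicit Arguments.
Unset Strict Implicit.
Unset Printing Implicit Defensive.

Local Open Scope classical_set_scope.
Local Open Scope ring_scope.

Section Mechanisms.
Context {R : realType} {n : nat}.

(* The signal space is S = [a, b]; a function on S^n is represented by a total
   function on R^n, of which only the values on S^n are ever used. *)
Variables a b : R.

Definition in_box (m : nat) (s : 'rV[R]_m) : Prop :=
  forall j, s ord0 j \in `[a, b].

(* The profile (s_i, s_{-i}): t lists the coordinates other than i. *)
Definition profile (i : 'I_n) (x : R) (t : 'rV[R]_n.-1) : 'rV[R]_n :=
  \row_j (if unlift i j is Some k then t ord0 k else x).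

Definition valuation (v : 'I_n -> 'rV[R]_n -> R) : Prop :=
  forall i t, in_box t ->
    [/\ convex_function `[a, b] (fun x : R => v i (profile i x t)),
        {within `[a, b], continuous (fun x : R => v i (profile i x t))} &
        {in `[a, b] &, {homo (fun x : R => v i (profile i x t)) :
                           x y / x <= y}}].

Definition subgradient (f : R -> R) (x g : R) : Prop :=
  forall y, y \in `[a, b] -> f x + g * (y - x) <= f y.

(* [d] is a version of f'. The endpoints of S, a null set, are left
   unconstrained because the subdifferential of f at b may be empty
   (vertical tangent). *)
Definition derivative_selection (f d : R -> R) : Prop :=
  forall x, x \in `]a, b[ ->
    (derivable f x 1 -> d x = derive1 f x) /\
    (~ derivable f x 1 -> subgradient f x (d x)).

Definition allocation_rule (q : 'I_n -> 'rV[R]_n -> R) : Prop :=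
  forall i s, in_box s -> 0 <= q i s <= 1.

Definition net_payoff (v q p : 'I_n -> 'rV[R]_n -> R) (i : 'I_n)
    (s : 'rV[R]_n) : R :=
  q i s * v i s - p i s.

Definition EPIC (v q p : 'I_n -> 'rV[R]_n -> R) : Prop :=
  forall i t, in_box t -> forall x x', x \in `[a, b] -> x' \in `[a, b] ->
    net_payoff v q p i (profile i x t) >=
    net_payoff v q p i (profile i x' t) +
      (v i (profile i x t) - v i (profile i x' t)) * q i (profile i x' t).

Definition flat_end (v : 'I_n -> 'rV[R]_n -> R) (i : 'I_n)
    (t : 'rV[R]_n.-1) : R :=
  sup [set x | x \in `[a, b] /\ v i (profile i x t) = v i (profile i a t)].

Definition eventually_monotone (v q : 'I_n -> 'rV[R]_n -> R) : Prop :=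
  forall i t, in_box t -> forall x x', x \in `[a, b] -> x' \in `[a, b] ->
    x > x' -> x > flat_end v i t ->
    q i (profile i x t) >= q i (profile i x' t).

End Mechanisms.

(* Main.v *)
(* Fix an agent i and s_{-i}, and write f, q, u for the valuation, allocation and
   net payoff as functions of the own signal, d for the derivative of f and l for
   the end of the flat part of f.  Adding two EPIC inequalities gives
   (q x - q y) (f x - f y) >= 0, hence monotonicity beyond l, where f is strictly
   increasing.  Since f y + d y (x - y) <= f x, EPIC also says that g = d q is a
   subgradient of u, so the payment formula is the fundamental theorem of calculus
   for a function with a given subgradient.  Conversely, g is nondecreasing even
   where q is not, because d = 0 before l; comparing d z * q z with d z * q y and
   integrating over z between y and x recovers EPIC. *)
Require Import Defs.
From HB Require Import structures.
From mathcomp Require Import all_boot all_order all_algebra.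
From mathcomp Require Import all_classical all_reals all_analysis.
From mathcomp Require Import measurable_realfun ring lra.
Import Order.TTheory GRing.Theory Num.Theory.
Import numFieldNormedType.Exports.

Set Implicit Arguments.
Unset Strict Implicit.
Unset Printing Implicit Defensive.

Local Open Scope classical_set_scope.
Local Open Scope ring_scope.

Local Notation mu := (@lebesgue_measure _) (only parsing).

(** * Monotone functions on an interval *)

(** The subgradient inequalities at [x] and [y] add up to [(g y - g x) * (y - x) >= 0]. *)
Lemma subgradient_nondecreasing (R : realFieldType) (I : {pred R})
    (g F : R -> R) :
  {in I &, forall x y, F y + g y * (x - y) <= F x} ->
  {in I &, {homo g : x y / x <= y}}.
Proof.
move=> sub x y xI yI; rewrite le_eqVlt => /predU1P[->//|xy].
have := sub _ _ xI yI; have := sub _ _ yI xI => h1 h2.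
have : 0 <= (g y - g x) * (y - x) by lra.
by rewrite pmulr_lge0 ?subr_gt0// subr_ge0.
Qed.

(** The preimage of a ray [[r, +oo[] under a nondecreasing function is an interval. *)
Lemma nondecreasing_in_measurable (R : realType) (D : set R) (f : R -> R) :
  is_interval D -> {in D &, {homo f : x y / x <= y}} -> measurable_fun D f.
Proof.
move=> iD fD mD.
apply: (measurability (@RGenCInfty.G R)) => //.
  exact: RGenCInfty.measurableE.
move=> /= _ [_ [r ->] <-].
apply: is_interval_measurable => s t /= [Ds].
rewrite in_itv/= andbT => rs [Dt _] u sut.
have Du : D u by exact: iD Ds Dt _ sut.
split=> //; rewrite in_itv/= andbT (le_trans rs)//.
by apply: fD; rewrite ?inE//; case/andP: sut.
Qed.

Lemma nondecreasing_integrable (R : realType) (g : R -> R) (c d : R) :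
  {in `[c, d]%classic &, {homo g : x y / x <= y}} ->
  mu.-integrable `[c, d] (EFin \o g).
Proof.
move=> gm; apply: measurable_bounded_integrable => //.
- by rewrite /= lebesgue_measure_itv; case: ifP => //= _; rewrite -EFinB ltry.
- by apply: nondecreasing_in_measurable => //; exact: interval_is_interval.
- exists (`|g c| + `|g d|); split; first by rewrite num_real.
  move=> M ltM x /= xcd; apply: le_trans (ltW ltM).
  have cd : c <= d by move: xcd; rewrite in_itv/= => /andP[]; exact: le_trans.
  have xc : g c <= g x.
    by apply: gm; rewrite ?inE /= ?in_itv /= ?lexx ?cd ?(itvP xcd).
  have xd : g x <= g d.
    by apply: gm; rewrite ?inE /= ?in_itv /= ?lexx ?cd ?(itvP xcd).
  rewrite ler_norml; apply/andP; split.
    by have := ler_norm (- g c); rewrite normrN; have := normr_ge0 (g d); lra.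
  by have := ler_norm (g d); have := normr_ge0 (g c); lra.
Qed.

Lemma nondecreasing_Rintegral_bounds (R : realType) (g : R -> R)
    (c d : R) : c <= d ->
  {in `[c, d]%classic &, {homo g : x y / x <= y}} ->
  g c * (d - c) <= \int[mu]_(x in `[c, d]) g x <= g d * (d - c).
Proof.
move=> cd gm; have gi := nondecreasing_integrable gm.
have ci (k : R) : mu.-integrable `[c, d] (EFin \o cst k).
  by apply: nondecreasing_integrable.
have Ic (k : R) : \int[mu]_(x in `[c, d]) cst k x = k * (d - c).
  rewrite Rintegral_cst//= lebesgue_measure_itv/= lte_fin.
  case: ltP => // dc; suff -> : d = c by rewrite subrr.
  by apply/eqP; rewrite eq_le dc.
rewrite -!Ic; apply/andP; split; apply: le_Rintegral => //= x xcd;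
  by apply: gm; rewrite ?inE /= ?in_itv /= ?lexx ?cd ?(itvP xcd).
Qed.

(** * The fundamental theorem of calculus for a subgradient *)

(** The inequality is assumed at the endpoints too, so [g] stays between [g c] and [g d]. *)
Lemma Rintegral_subgradient_compact (R : realType) (g F : R -> R)
    (c d : R) : c <= d ->
  {in `[c, d] &, forall x y, F y + g y * (x - y) <= F x} ->
  \int[mu]_(x in `[c, d]) g x = F d - F c.
Proof.
move=> cd sub.
have gm := subgradient_nondecreasing sub.
have gmI x y : c <= x -> x <= y -> y <= d ->
    {in `[x, y]%classic &, {homo g : x y / x <= y}}.
  move=> cx xy yd u w; rewrite !inE /= !in_itv/= => /andP[? ?] /andP[? ?].
  by apply: gm; rewrite in_itv/=; apply/andP; split; lra.
pose I x y := \int[mu]_(z in `[x, y]) g z.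
have Isplit x m y : c <= x -> x <= m -> m <= y -> y <= d ->
    I x y = I x m + I m y.
  move=> cx xm my yd; have xy := le_trans xm my.
  have gi := nondecreasing_integrable (gmI x y cx xy yd).
  have := @Rintegral_itvB _ g (BLeft x) (BRight y) m gi.
  rewrite !bnd_simp => /(_ xm my) e.
  rewrite Rintegral_itv_obnd_cbnd in e; last first.
    apply: integrableS gi => //; apply: subset_itvr; by rewrite bnd_simp.
  by rewrite /I -e addrC subrK.
(* [I x y] and [F y - F x] both lie between [g x * (y - x)] and
   [g y * (y - x)]; each halving of the interval halves this error bound. *)
have H n : forall x y, c <= x -> x <= y -> y <= d ->
    `|I x y - (F y - F x)| <= (g y - g x) * (y - x) / 2 ^+ n.
  elim: n => [|n IHn] x y cx xy yd.
    have /andP[] := nondecreasing_Rintegral_bounds xy (gmI x y cx xy yd).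
    have xI : x \in `[c, d] by rewrite in_itv/= cx (le_trans xy).
    have yI : y \in `[c, d] by rewrite in_itv/= yd (le_trans cx).
    have := sub _ _ xI yI; have := sub _ _ yI xI; rewrite -/(I x y).
    by rewrite expr0 divr1 ler_norml => *; apply/andP; split; nra.
  pose m := (x + y) / 2.
  have xm : x <= m by rewrite /m; lra.
  have my : m <= y by rewrite /m; lra.
  have h1 := IHn x m cx xm (le_trans my yd).
  have h2 := IHn m y (le_trans cx xm) my yd.
  rewrite (Isplit x m y)//.
  have -> : I x m + I m y - (F y - F x) =
    (I x m - (F m - F x)) + (I m y - (F y - F m)) by ring.
  apply: le_trans (ler_normD _ _) _; apply: le_trans (lerD h1 h2) _.
  (* Both halves have length [(y - x) / 2] and the increments of [g] telescope, so this is an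
     equality. *)
  rewrite le_eqVlt; apply/orP; left; apply/eqP.
  rewrite exprS /m; field.
  by rewrite expf_neq0// pnatr_eq0.
apply/eqP; rewrite -subr_eq0 -normr_le0; apply/ler_addgt0Pr => e e0; rewrite add0r.
pose K := (g d - g c) * (d - c).
(* [K / e] is below [k = trunc (K / e) + 1], and [k < 2 ^ k]. *)
have [n Kn] : exists n, K / e < 2 ^+ n.
  exists (Num.trunc (K / e)).+1.
  apply: lt_le_trans (truncnS_gt _) _.
  by rewrite -natrX ler_nat ltnW// ltn_expl.
apply: le_trans (H n c d (lexx _) cd (lexx _)) _.
rewrite ler_pdivrMr ?exprn_gt0//; move: Kn; rewrite ltr_pdivrMr// mulrC.
exact: ltW.
Qed.

(** [g] may blow up at [a] and [b], as with a vertical tangent, so the compact case is applied to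
    intervals exhausting []a, b[]; monotone convergence and the continuity of [F] at the endpoints
    give the limit. *)
Lemma integral_subgradient_oo (R : realType) (g F : R -> R) (a b : R) :
  a < b -> {within `[a, b], continuous F} ->
  {in `]a, b[, forall y, 0 <= g y} ->
  {in `]a, b[ &, forall x y, F y + g y * (x - y) <= F x} ->
  (\int[mu]_(x in `]a, b[) (g x)%:E = (F b - F a)%:E)%E.
Proof.
move=> ab /(continuous_within_itvP _ ab)[_ Fa Fb] g0 sub.
(* The denominator starts at 2, so that [a + e n <= b - e n] already for [n = 0]. *)
pose e (n : nat) : R := (b - a) / n.+2%:R.
have ba0 : 0 < b - a by rewrite subr_gt0.
have e0 n : 0 < e n by rewrite divr_gt0.
have en n : a + e n <= b - e n.
  have : e n * 2 <= b - a.
    by rewrite /e mulrAC ler_pdivrMr// ler_pM2l// ler_nat.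
  lra.
have e_cvg : e n @[n --> \oo] --> (0 : R).
  rewrite -(mulr0 (b - a)); apply: cvgM; first exact: cvg_cst.
  by have := @cvg_harmonic R; rewrite -(cvg_shiftS (@harmonic R)).
have e_ni m n : (m <= n)%N -> e n <= e m.
  by move=> mn; rewrite ler_pM2l// lef_pV2 ?posrE// ler_nat.
pose J n : set R := `[a + e n, b - e n]%classic.
have JE : \bigcup_n J n = `]a, b[%classic.
  apply/seteqP; split=> [x [n _]|x]; rewrite /J /= !in_itv/=.
    by have e0n := e0 n; move=> /andP[? ?]; apply/andP; split; lra.
  move=> /andP[ax xb].
  have m0 : 0 < Num.min (x - a) (b - x) by rewrite lt_min !subr_gt0 ax.
  have [N _ /(_ N (leqnn N))] := cvgr_lt _ e_cvg _ m0.
  rewrite /= lt_min => /andP[? ?]; exists N => //.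
  by rewrite /J /= in_itv/=; apply/andP; split; lra.
have Jsub n : {subset `[a + e n, b - e n] <= `]a, b[}.
  move=> x; rewrite !in_itv/= => /andP[? ?]; have := e0 n.
  by move=> ?; apply/andP; split; lra.
have gm := subgradient_nondecreasing sub.
have gmJ n : {in J n &, {homo g : x y / x <= y}}.
  by move=> x y /set_mem/Jsub xI /set_mem/Jsub yI; exact: gm.
have IJ n : (\int[mu]_(x in J n) (g x)%:E =
             (F (b - e n) - F (a + e n))%:E)%E.
  have sub' : {in `[a + e n, b - e n] &,
      forall x y, F y + g y * (x - y) <= F x}.
    by move=> x y /Jsub xI /Jsub yI; exact: sub.
  rewrite -(Rintegral_subgradient_compact (en n) sub') fineK//.
  apply: integrable_fin_num; first exact: measurable_itv.
  exact: nondecreasing_integrable (@gmJ n).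
have cvgI : (\int[mu]_(x in J n) (g x)%:E)%E @[n --> \oo] -->
    (\int[mu]_(x in `]a, b[) (g x)%:E)%E.
  rewrite -JE; apply: ge0_nondecreasing_set_cvg_integral.
  - move=> m n mn; apply/subsetPset; apply: subset_itv.
      by rewrite bnd_simp lerD2l e_ni.
    by rewrite bnd_simp lerB// e_ni.
  - by move=> n; apply: measurable_itv.
  - move=> n; apply/measurable_EFinP.
    apply: nondecreasing_in_measurable (@gmJ n).
    exact: interval_is_interval.
  - by move=> n x /Jsub/g0; rewrite /= lee_fin.
apply: (cvg_unique _ cvgI) => //.
rewrite /=; under eq_fun do rewrite IJ.
apply: cvg_EFin; first exact: nearW.
apply: cvgB.
- move/cvg_at_leftP : Fb; apply; split=> [n|]; first by rewrite ltrBlDr ltrDl.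
  by rewrite -[X in _ --> X]subr0; apply: cvgB => //; exact: cvg_cst.
- move/cvg_at_rightP : Fa; apply; split=> [n|]; first by rewrite ltrDl.
  by rewrite -[X in _ --> X]addr0; apply: cvgD => //; exact: cvg_cst.
Qed.

(** * Subgradients of a convex function *)

Lemma convex_function_itvE (R : realType) (a b : R) (f : R -> R) :
  convex_function `[a, b] f ->
  forall x y t, x \in `[a, b] -> y \in `[a, b] -> 0 <= t <= 1 ->
    f (t * x + (1 - t) * y) <= t * f x + (1 - t) * f y.
Proof.
move=> cf x y t xI yI /andP[t0 t1].
exact: (cf (Itv01 t0 t1) x y (mem_set xI) (mem_set yI)).
Qed.

(** Convexity bounds the difference quotient [(f (x + h (y - x)) - f x) / h] by [f y - f x] for
    [0 < h < 1]; then [h] tends to 0 from the right. *)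
Lemma derive1_subgradient (R : realType) (a b : R) (f : R -> R) (x : R) :
  convex_function `[a, b] f -> x \in `]a, b[ -> derivable f x 1 ->
  subgradient a b f x (derive1 f x).
Proof.
move=> /convex_function_itvE cf xI dfx y yI.
have df : differentiable f x by exact/derivable1_diffP.
have -> : derive1 f x * (y - x) = 'D_(y - x) f x.
  rewrite deriveE// derive1E'// mulrC -[in RHS](mulr1 (y - x)).
  exact/esym/(linearZ_LR ('d f x) (y - x) 1).
have := @diff_derivable _ _ _ _ _ (y - x) df.
move=> /cvg_ex[/= l fl].
have -> : 'D_(y - x) f x = l by apply/cvg_lim.
have {}fl : h^-1 *: (f (h *: (y - x) + x) - f x) @[h --> 0^'+] --> l.
  exact: (cvg_dnbhs_at_right fl).
rewrite addrC -lerBrDr; apply: (cvgr_to_le fl).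
near=> h.
have h0 : 0 < h by near: h; exact: nbhs_right_gt.
have h1 : h < 1 by near: h; exact: nbhs_right_lt.
have xI' : x \in `[a, b] by exact: subset_itv_oo_cc.
have := cf y x h yI xI' _; rewrite (ltW h0) (ltW h1) => /(_ isT).
have -> : h *: (y - x) + x = h * y + (1 - h) * x.
  by rewrite -[_ *: _]/(h * (y - x)); ring.
move=> H; rewrite -[_ *: _]/(h^-1 * _) mulrC ler_pdivrMr//; lra.
Unshelve. all: by end_near.
Qed.

Lemma derivative_selection_subgradient (R : realType) (a b : R) (f d : R -> R) :
  convex_function `[a, b] f -> derivative_selection a b f d ->
  forall x, x \in `]a, b[ -> subgradient a b f x (d x).
Proof.
move=> cf df x xI; have [d1 d2] := df x xI.
have [fx|/d2//] := pselect (derivable f x 1).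
by rewrite d1//; exact: derive1_subgradient.
Qed.

(** * Integrals over open and closed intervals *)

Lemma integral_itv_oo_cc (R : realType) (x y : R) (f : R -> \bar R) :
  measurable_fun `]x, y[ f ->
  (\int[mu]_(z in `]x, y[) f z = \int[mu]_(z in `[x, y]) f z)%E.
Proof.
move=> mf; rewrite integral_itv_bndo_bndc// integral_itv_obnd_cbnd//.
exact/emeasurable_fun_itv_bndo_bndcP.
Qed.

Lemma integrable_itv_oo_cc (R : realType) (x y : R) (f : R -> \bar R) :
  mu.-integrable `]x, y[ f -> mu.-integrable `[x, y] f.
Proof.
move=> /integrableP[mf intf]; apply/integrableP; split.
  exact/emeasurable_fun_itv_obnd_cbndP/emeasurable_fun_itv_bndo_bndcP.
by rewrite -integral_itv_oo_cc//; exact: measurableT_comp.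
Qed.

Lemma Rintegral_itv_oo_cc (R : realType) (x y : R) (f : R -> R) :
  mu.-integrable `]x, y[ (EFin \o f) ->
  \int[mu]_(z in `]x, y[) f z = \int[mu]_(z in `[x, y]) f z.
Proof.
by move=> intf; rewrite /Rintegral integral_itv_oo_cc//; exact: measurable_int intf.
Qed.

(** For nonnegative [g], the finite value of the integral over the open interval already gives
    integrability. The hypotheses on [g] concern []a, b[] only, because a derivative selection is
    arbitrary at [a] and [b]. *)
Lemma subgradient_integrable (R : realType) (g F : R -> R) (a b : R) :
  {within `[a, b], continuous F} ->
  {in `]a, b[, forall y, 0 <= g y} ->
  {in `]a, b[ &, forall x y, F y + g y * (x - y) <= F x} ->
  forall x y, a <= x -> x <= y -> y <= b ->
  mu.-integrable `[x, y] (EFin \o g) /\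
  \int[mu]_(z in `[x, y]) g z = F y - F x.
Proof.
move=> Fc g0 sub x y ax; rewrite le_eqVlt => /predU1P[<- xb|xy yb].
  rewrite set_itv1 Rintegral_set1 subrr; split=> //.
  by rewrite -set_itv1; apply: integrable_itv_oo_cc;
    rewrite set_itvoo0//; exact: integrable_set0.
have xyS z : z \in `]x, y[ -> z \in `]a, b[.
  by rewrite !in_itv/= => /andP[? ?]; apply/andP; split; lra.
have E : (\int[mu]_(z in `]x, y[) (g z)%:E = (F y - F x)%:E)%E.
  apply: integral_subgradient_oo => //.
  - apply: continuous_subspaceW Fc; apply: subset_itv; by rewrite bnd_simp.
  - by move=> z /xyS; exact: g0.
  - by move=> z w /xyS zI /xyS wI; exact: sub.
have ig : mu.-integrable `]x, y[ (EFin \o g).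
  apply/integrableP; split.
    apply/measurable_EFinP; apply: nondecreasing_in_measurable.
      exact: interval_is_interval.
    move=> z w /set_mem/xyS zI /set_mem/xyS wI.
    exact: (subgradient_nondecreasing sub).
  have -> : (\int[mu]_(z in `]x, y[) `|(EFin \o g) z| =
             \int[mu]_(z in `]x, y[) (g z)%:E)%E.
    by apply: eq_integral => z /set_mem/xyS/g0 gz /=; rewrite ger0_norm.
  by rewrite E ltry.
split; first exact: integrable_itv_oo_cc.
by rewrite -Rintegral_itv_oo_cc// /Rintegral E.
Qed.

(** * One agent, with the signals of the others fixed *)

Section one_agent.
Variables (R : realType) (a b : R) (f d Q U : R -> R).
Hypothesis ab : a <= b.
Hypothesis cvxf : convex_function `[a, b] f.
Hypothesis ctsf : {within `[a, b], continuous f}.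
Hypothesis ndf : {in `[a, b] &, {homo f : x y / x <= y}}.
Hypothesis df : derivative_selection a b f d.
Hypothesis Q01 : {in `[a, b], forall x, 0 <= Q x <= 1}.

Let flat := [set x | x \in `[a, b] /\ f x = f a].
Let l := sup flat.

Let aI : a \in `[a, b]. Proof. by rewrite in_itv/= lexx. Qed.

Let oocc x : x \in `]a, b[ -> x \in `[a, b].
Proof. exact: subset_itv_oo_cc. Qed.

(** [flat] is nonempty and bounded above, so [l] is a true supremum and not the default value of
    [sup]. *)
Let flata : flat a. Proof. by []. Qed.

Let has_ubound_flat : has_ubound flat.
Proof. by exists b => x [+ _]; rewrite in_itv/= => /andP[]. Qed.

Let al : a <= l. Proof. exact: ub_le_sup. Qed.

Let lb : l <= b.
Proof.
apply: ge_sup; first by exists a.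
by move=> x [+ _]; rewrite in_itv/= => /andP[].
Qed.

Let lI : l \in `[a, b]. Proof. by rewrite in_itv/= al lb. Qed.

Let d_sub x y : x \in `]a, b[ -> y \in `[a, b] -> f x + d x * (y - x) <= f y.
Proof. by move=> xI yI; exact: (derivative_selection_subgradient cvxf df). Qed.

(** Test the subgradient inequality at [x] against the left endpoint [a]. *)
Let d_ge0 : {in `]a, b[, forall x, 0 <= d x}.
Proof.
move=> x xI; have := d_sub xI aI; have := ndf aI (oocc xI).
move: xI; rewrite in_itv/= => /andP[ax xb] /(_ (ltW ax)) h1 h2.
have : 0 <= d x * (x - a) by nra.
by rewrite pmulr_lge0// subr_gt0.
Qed.

(** Some [w > x] lies in [flat]; testing at [w] gives [d x * (w - x) <= f a - f x <= 0]. *)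
Let d_flat x : x \in `]a, b[ -> x < l -> d x = 0.
Proof.
move=> xI xl; have [|w [wI fw] xw] := @sup_gt _ flat x _ xl; first by exists a.
apply/eqP; rewrite eq_le d_ge0// andbT.
have := d_sub xI wI; have := ndf aI (oocc xI).
move: xI; rewrite in_itv/= => /andP[ax xb] /(_ (ltW ax)); rewrite fw => h1 h2.
have : d x * (w - x) <= 0 by lra.
by rewrite pmulr_lle0// subr_gt0.
Qed.

Let d_subo : {in `]a, b[ &, forall x y, f y + d y * (x - y) <= f x}.
Proof. by move=> x y xI yI; apply: d_sub => //; exact: oocc. Qed.

Let d_int x y : a <= x -> x <= y -> y <= b ->
  mu.-integrable `[x, y] (EFin \o d) /\
  \int[mu]_(z in `[x, y]) d z = f y - f x.
Proof. exact: subgradient_integrable. Qed.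

(** The supremum is attained: [f l - f a] is the integral of [d], which vanishes on []a, l[]. *)
Let f_flat : f l = f a.
Proof.
have [_ H] := d_int (lexx a) al lb.
apply/eqP; rewrite -subr_eq0 -H -Rintegral_itv_oo_cc; last first.
  have [di _] := d_int (lexx a) al lb.
  by apply: integrableS di => //; exact: subset_itv_oo_cc.
rewrite (eq_Rintegral _ (g := cst 0)); first by rewrite Rintegral_cst// mul0r.
move=> z /set_mem; rewrite /= in_itv/= => /andP[az zl].
by apply: d_flat => //; rewrite in_itv/= az (lt_le_trans zl).
Qed.

Let f_flat_le x : x \in `[a, b] -> x <= l -> f x = f a.
Proof.
move=> xI xl; apply/eqP; rewrite eq_le -{1}f_flat !ndf//.
by move: xI; rewrite in_itv/= => /andP[].
Qed.

(** [x] is a convex combination of [a] and [y] with positive weight on [a], and [f a < f y] because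
    [y] lies beyond [l]. *)
Let f_incr x y : x \in `[a, b] -> y \in `[a, b] -> x < y -> l < y -> f x < f y.
Proof.
move=> xI yI xy ly; have := xI; rewrite in_itv/= => /andP[ax xb].
have fay : f a < f y.
  rewrite lt_neqAle ndf ?andbT//; last by rewrite (le_trans ax)// ltW.
  apply/eqP => fy; suff : y <= l by rewrite leNgt ly.
  exact: ub_le_sup.
have ya : 0 < y - a by rewrite subr_gt0 (le_lt_trans ax).
pose t := (y - x) / (y - a).
have t0 : 0 < t by rewrite divr_gt0// subr_gt0.
have t1 : t <= 1 by rewrite ler_pdivrMr// mul1r; lra.
have := convex_function_itvE cvxf aI yI (t := t); rewrite (ltW t0) t1 => /(_ isT).
have -> : t * a + (1 - t) * y = x by rewrite /t; field; rewrite gt_eqF.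
by move=> /le_lt_trans; apply; nra.
Qed.

(** * Incentive compatibility and the envelope formula *)

Let Q_mono := forall x x', x \in `[a, b] -> x' \in `[a, b] ->
  x > x' -> x > l -> Q x >= Q x'.

Let g z := d z * Q z.

Let g_ge0 : {in `]a, b[, forall z, 0 <= g z}.
Proof.
move=> z zI; rewrite mulr_ge0 ?d_ge0//.
by have /andP[] := Q01 (oocc zI).
Qed.

Let g_le_d : {in `]a, b[, forall z, g z <= d z}.
Proof.
move=> z zI; rewrite ler_piMr ?d_ge0//.
by have /andP[] := Q01 (oocc zI).
Qed.

Let g_nondecreasing : Q_mono -> {in `]a, b[ &, {homo g : x y / x <= y}}.
Proof.
move=> mQ x y xI yI; rewrite le_eqVlt => /predU1P[->//|xy].
(* In the remaining case [l <= x < y], so [y] exceeds [l] even if [x = l], and both nonnegative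
   factors of [g] do not decrease from [x] to [y]. *)
have [xl|lx] := ltP x l; first by rewrite {1}/g d_flat// mul0r g_ge0.
apply: ler_pM; rewrite ?d_ge0//.
- by have /andP[] := Q01 (oocc xI).
- by apply: (subgradient_nondecreasing d_subo) => //; exact: ltW.
- by apply: mQ; rewrite ?oocc// (le_lt_trans lx).
Qed.

(** [g] is measurable by monotonicity and dominated by the integrable [d]. *)
Let g_integrable x y : Q_mono -> a <= x -> y <= b ->
  mu.-integrable `]x, y[ (EFin \o g).
Proof.
move=> mQ ax yb.
suff gI : mu.-integrable `]a, b[ (EFin \o g).
  by apply: integrableS gI => //; apply: subset_itv; rewrite bnd_simp.
have dI : mu.-integrable `]a, b[ (EFin \o d).
  have [di _] := d_int (lexx a) ab (lexx b).
  by apply: integrableS di => //; exact: subset_itv_oo_cc.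
apply: le_integrable dI => //.
  apply/measurable_EFinP; apply: nondecreasing_in_measurable.
    exact: interval_is_interval.
  by move=> z w /set_mem zI /set_mem wI; exact: g_nondecreasing.
by move=> z zI /=; rewrite lee_fin !ger0_norm ?g_ge0 ?d_ge0 ?g_le_d.
Qed.

Let EPIC1 := forall x x', x \in `[a, b] -> x' \in `[a, b] ->
  U x' + (f x - f x') * Q x' <= U x.

(** The payment formula, solved for the net payoff [U]. *)
Let envelope := forall x, x \in `[a, b] ->
  U x = U a + \int[mu]_(z in `[a, x]) (d z * Q z).

Let EPIC1_mono : EPIC1 -> Q_mono.
Proof.
move=> ic x y xI yI yx lx.
have := ic _ _ xI yI; have := ic _ _ yI xI => h1 h2.
have fxy := f_incr yI xI yx lx.
have : 0 <= (Q x - Q y) * (f x - f y) by lra.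
by rewrite pmulr_lge0 ?subr_gt0// subr_ge0.
Qed.

(** Since [0 <= Q <= 1], incentive compatibility in both directions gives [|U w - U u| <= f w - f u]
    for [u <= w]. *)
Let EPIC1_continuous : EPIC1 -> {within `[a, b], continuous U}.
Proof.
move=> ic; apply/subspace_continuousP => x xI; apply/cvgrPdist_lt => e e0.
move/subspace_continuousP : ctsf => /(_ x xI) /cvgrPdist_lt /(_ e e0).
apply: filterS2 (withinT _ _) => y yI; apply: le_lt_trans.
have Hxy u w : u \in `[a, b] -> w \in `[a, b] -> u <= w ->
    `|U w - U u| <= f w - f u.
  move=> uI wI uw; have fuw := ndf uI wI uw.
  have := ic _ _ uI wI; have := ic _ _ wI uI.
  have /andP[? ?] := Q01 uI; have /andP[? ?] := Q01 wI.
  by move=> h1 h2; rewrite ler_norml; apply/andP; split; nra.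
have [xy|/ltW yx] := leP x y.
  by rewrite distrC [leRHS]distrC (le_trans (Hxy _ _ xI yI xy))// ler_norm.
by rewrite (le_trans (Hxy _ _ yI xI yx))// ler_norm.
Qed.

Lemma EPIC1_envelopeP : EPIC1 <-> Q_mono /\ envelope.
Proof.
split=> [ic|[mQ env]].
  split=> [|x xI]; first exact: EPIC1_mono.
  have /andP[ax xb] : a <= x <= b by move: xI; rewrite in_itv.
  have g_sub : {in `]a, b[ &, forall z y, U y + g y * (z - y) <= U z}.
    move=> z y zI yI; apply: le_trans (ic _ _ (oocc zI) (oocc yI)).
    have /andP[? _] := Q01 (oocc yI); have := d_sub yI (oocc zI).
    by rewrite /g => h; rewrite lerD2l; nra.
  have [_ ->] := subgradient_integrable (EPIC1_continuous ic) g_ge0 g_sub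
    (lexx a) ax xb.
  by rewrite addrC subrK.
(* Open intervals are used because [d] and [g] are controlled only inside []a, b[]. *)
have envB x y : a <= x -> x <= y -> y <= b ->
    U y - U x = \int[mu]_(z in `]x, y[) g z.
  move=> ax xy yb; rewrite env; last by rewrite in_itv/= yb (le_trans ax).
  rewrite [U x]env; last by rewrite in_itv/= ax (le_trans xy).
  have gi := integrable_itv_oo_cc (g_integrable mQ (lexx a) yb).
  rewrite opprD addrACA subrr add0r Rintegral_itvB ?bnd_simp//.
  rewrite Rintegral_itv_obnd_cbnd; last first.
    by apply: integrableS gi => //; apply: subset_itv; rewrite bnd_simp.
  by rewrite Rintegral_itv_oo_cc//; exact: g_integrable.
have dB x y k : a <= x -> x <= y -> y <= b ->
    mu.-integrable `]x, y[ (EFin \o (fun z => d z * k)) /\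
    (f y - f x) * k = \int[mu]_(z in `]x, y[) (d z * k).
  move=> ax xy yb; have [di dE] := d_int ax xy yb.
  have di' : mu.-integrable `]x, y[ (EFin \o d).
    by apply: integrableS di => //; exact: subset_itv_oo_cc.
  split; last by rewrite RintegralZr// Rintegral_itv_oo_cc// dE.
  rewrite (_ : _ \o _ = (fun z => (EFin \o d) z * k%:E)%E)//.
  exact: integrableZr.
have U_nd x y : a <= x -> x <= y -> y <= b -> U x <= U y.
  move=> ax xy yb; rewrite -subr_ge0 envB//; apply: Rintegral_ge0 => z.
  rewrite /= in_itv/= => /andP[xz zy]; apply: g_ge0.
  by rewrite in_itv/=; apply/andP; split; lra.
move=> x y xI yI.
have /andP[ax xb] : a <= x <= b by move: xI; rewrite in_itv.
have /andP[ay yb] : a <= y <= b by move: yI; rewrite in_itv.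
(* Here [x] is the true signal and [y] the report; overreports come first. *)
have [xy|/ltW yx] := leP x y.
  suff : U y - U x <= (f y - f x) * Q y by lra.
  have [di ->] := dB x y (Q y) ax xy yb.
  rewrite envB//; apply: le_Rintegral => //; first exact: g_integrable.
  move=> z; rewrite /= in_itv/= => /andP[xz zy].
  have zI : z \in `]a, b[ by rewrite in_itv/=; apply/andP; split; lra.
  (* Monotonicity compares [Q z] with [Q y] only when [y > l]; otherwise [d z = 0], since
     [z < y <= l]. *)
  have [yl|ly] := leP y l; first by rewrite /g d_flat ?mul0r// (lt_le_trans zy).
  by rewrite ler_wpM2l ?d_ge0//; apply: mQ => //; exact: oocc.
(* If [x <= l], then [f] is constant on [[a, x]] and the claim reduces to [U y <= U x]. *)
have [xl|lx] := leP x l.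
  by rewrite !f_flat_le// ?(le_trans yx)// subrr mul0r addr0 U_nd.
(* [q] need not be monotone on [y, l], but there [f] is constant and [U] is
   nondecreasing, so the inequality is only needed from [max y l] on. *)
pose m := Num.max y l.
have ym : y <= m by rewrite le_max lexx.
have mx : m <= x by rewrite ge_max yx ltW.
have fm : f m = f y.
  rewrite /m; case: leP => // yl.
  by rewrite f_flat (@f_flat_le y).
have Uym := U_nd y m ay ym (le_trans mx xb).
suff : (f x - f m) * Q y <= U x - U m by rewrite fm; lra.
have am := le_trans ay ym.
have [di ->] := dB m x (Q y) am mx xb.
rewrite envB//; apply: le_Rintegral => //; first exact: g_integrable.
move=> z; rewrite /= in_itv/= => /andP[mz zx].
have zI : z \in `]a, b[ by rewrite in_itv/=; apply/andP; split; lra.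
rewrite ler_wpM2l ?d_ge0//; move: mz; rewrite gt_max => /andP[yz lz].
by apply: mQ => //; exact: oocc.
Qed.

End one_agent.

(** * From one agent to the mechanism *)

Theorem proposition1 (R : realType) (n : nat) (a b : R) (hab : a <= b)
    (v : 'I_n -> 'rV[R]_n -> R) (hv : valuation a b v)
    (dv : 'I_n -> R -> 'rV[R]_n.-1 -> R)
    (hdv : forall i t, in_box a b t ->
       derivative_selection a b (fun x => v i (profile i x t))
         (fun x => dv i x t))
    (q p : 'I_n -> 'rV[R]_n -> R) (hq : allocation_rule a b q) :
  EPIC a b v q p <->
  eventually_monotone a b v q /\
  (forall i x t, x \in `[a, b] -> in_box a b t ->
     p i (profile i x t) =
       p i (profile i a t) - q i (profile i a t) * v i (profile i a t)
       + q i (profile i x t) * v i (profile i x t)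
       - \int[lebesgue_measure]_(y in `[a, x])
           (dv i y t * q i (profile i y t))).
Proof.
have box (i : 'I_n) x t : in_box a b t -> x \in `[a, b] -> in_box a b (profile i x t).
  by move=> tI xI j; rewrite mxE; case: unlift.
(* The one-agent conditions are convertible to [EPIC] and [eventually_monotone] at [i] and [t]; only
   the payment formula has to be rearranged. *)
have main i t (tI : in_box a b t) :=
  let: And3 cvxv ctsv ndv := hv i t tI in
  EPIC1_envelopeP (net_payoff v q p i \o fun x => profile i x t) hab
    cvxv ctsv ndv (hdv i t tI)
    (fun x xI => hq i (profile i x t) (box i x t tI xI)).
split=> [ic|[mq pay] i t tI].
  split=> [i t tI|i x t xI tI].
    by have [mono _] := (main i t tI).1 (ic i t tI).
  have [_ /(_ x xI)] := (main i t tI).1 (ic i t tI).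
  by rewrite /= /net_payoff => e; lra.
apply/(main i t tI); split=> [|x xI]; first exact: mq.
by rewrite /= /net_payoff (pay i x t)//; ring.
Qed.
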